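(* Let $\Gamma$ be a finitely generated group which is hyperbolic relative to subgroups $\{H_i\}_{i=1}^k$ in the sense of Bowditch. Consider the collection of subgroups of $\Gamma$ consisting of: (1) all conjugates $gH_ig^{-1}$, $g\in\Gamma$, $1\le i\le k$ (the peripheral subgroups); (2) all maximal infinite virtually cyclic subgroups $V\le\Gamma$ such that $V\not\subseteq gH_ig^{-1}$ for all $i=1,\dots,k$ and all $g\in\Gamma$. Then this collection is adapted to the pair $(\mathcal{FIN},\mathcal{VC})$, where $\mathcal{FIN}$ is the family of finite subgroups of $\Gamma$ and $\mathcal{VC}$ is the family of virtually cyclic subgroups of $\Gamma$.
   Context: A group is virtually cyclic if it has a cyclic subgroup of finite index (finite groups are included). Relative hyperbolicity in the sense of Bowditch: $\Gamma$ is hyperbolic relative to $\{H_i\}_{i=1}^k$ if $\Gamma$ acts on a connected graph $K$ such that: $K$ is Gromov hyperbolic, and for each $n$ each edge of $K$ is contained in only finitely many circuits of length $n$; there are finitely many $\Gamma$-orbits of edges, and edge stabilizers are finite; the infinite vertex stabilizers are precisely the conjugates of the $H_i$ (in particular the $H_i$ are infinite); and each $H_i$ is finitely generated. (This is equivalent to relative hyperbolicity with the bounded coset penetration property in the sense of Farb.) A collection $\{H_\alpha\}_{\alpha\in I}$ of subgroups of $\Gamma$ is adapted to a pair of families $\mathcal F\subset\widetilde{\mathcal F}$ of subgroups of $\Gamma$ if: (1) for all $G,H\in\{H_\alpha\}$, either $G=H$ or $G\cap H\in\mathcal F$; (2) if $G\in\{H_\alpha\}$ then $gGg^{-1}\in\{H_\alpha\}$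 for all $g\in\Gamma$; (3) every $G\in\{H_\alpha\}$ satisfies $N_\Gamma(G)=G$; (4) for every $G\in\widetilde{\mathcal F}\setminus\mathcal F$ there is $H\in\{H_\alpha\}$ with $G\le H$. *)

(* Defs.v *)
From HB Require Import structures.
From mathcomp Require Import all_boot.
From mathcomp Require Import boolp classical_sets functions cardinality.
Set Implicit Arguments.
Unset Strict Implicit.
Unset Printing Implicit Defensive.
Local Open Scope classical_set_scope.
Local Open Scope group_scope.

(** * Subgroups of a (possibly infinite) group, as classical sets *)
Section Subgroups.
Variable G : groupType.
Implicit Types (A B C N V : set G) (g x y : G).

Definition is_subgroup A : Prop :=
  [/\ A 1, forall x y, A x -> A y -> A (x * y) & forall x, A x -> A x^-1].

Definition generated A : set G := smallest is_subgroup A.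

Definition finitely_generated A : Prop :=
  exists2 B : set G, finite_set B & A = generated B.

(* The library's conjugation [x ^ g] is [g^-1 * x * g]; this one is g A g^-1. *)
Definition conj_set g A : set G := [set g * x * g^-1 | x in A].

Definition normaliser A : set G := [set g | conj_set g A = A].

Definition cyclic_subgroup A : Prop := exists c : G, A = generated [set c].

Definition left_coset g C : set G := [set g * x | x in C].

Definition finite_index C A : Prop :=
  C `<=` A /\ finite_set [set left_coset g C | g in A].

Definition virtually_cyclic A : Prop :=
  exists2 C : set G, cyclic_subgroup C & finite_index C A.

Definition FIN : set (set G) := [set A | is_subgroup A /\ finite_set A].

Definition VC : set (set G) := [set A | is_subgroup A /\ virtually_cyclic A].

Definition infinite_vc : set (set G) := [set A | VC A /\ infinite_set A].

Definition maximal_infinite_vc V : Prop :=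
  infinite_vc V /\ forall N, infinite_vc N -> V `<=` N -> N = V.

(** A collection of subgroups is identified with the set of its members. *)
Record adapted (F Ft HH : set (set G)) : Prop := Adapted {
  adapted_families : F `<=` Ft;
  adapted_subgroups : HH `<=` is_subgroup;
  adapted_inter : forall A B, HH A -> HH B -> A = B \/ F (A `&` B);
  adapted_conj : forall A g, HH A -> HH (conj_set g A);
  adapted_normaliser : forall A, HH A -> normaliser A = A;
  adapted_cover : forall A, (Ft `\` F) A -> exists2 B, HH B & A `<=` B
}.

End Subgroups.

(** * Graphs: vertex type with a symmetric irreflexive adjacency relation *)
Section Graphs.
Variables (V : choiceType) (e : rel V).

Definition simple_graph : Prop := symmetric e /\ irreflexive e.

(* A connected graph is nonempty: with no vertices allowed, every group would
   be hyperbolic relative to the empty collection. *)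
Definition connected_graph : Prop :=
  inhabited V /\ forall x y, exists2 p : seq V, path e x p & last x p = y.

Definition path_between (x y : V) (p : seq V) : Prop :=
  path e x p /\ last x p = y.

Definition geodesic (x y : V) (p : seq V) : Prop :=
  path_between x y p /\ forall q, path_between x y q -> size p <= size q.

(* Slim triangles.  One side suffices: the reverse of a geodesic is a geodesic,
   so the other two sides are covered by permuting x, y and z. *)
Definition gromov_hyperbolic : Prop :=
  exists delta : nat, forall (x y z : V) (p q r : seq V),
    geodesic x y p -> geodesic y z q -> geodesic x z r ->
    forall w, w \in x :: p ->
      exists2 w', (w' \in y :: q) || (w' \in x :: r) &
        exists2 s, path_between w w' s & size s <= delta.

Definition edges : set (set V) :=
  [set E | exists x y, e x y /\ E = [set x; y]].

(* A circuit x_0, ..., x_(n-1), listed from some base point in some direction;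
   a geometric circuit of length n has exactly 2n such listings, so counting
   listings does not affect finiteness. *)
Definition circuit (c : seq V) : Prop := 2 < size c /\ ucycle e c.

Definition circuit_contains (c : seq V) (E : set V) : Prop :=
  exists2 x, x \in c & E = [set x; next c x].

Definition fine : Prop := forall (n : nat) (E : set V), edges E ->
  finite_set [set c | [/\ circuit c, size c = n & circuit_contains c E]].

End Graphs.

(** * Relative hyperbolicity in the sense of Bowditch *)
Section RelativelyHyperbolic.
Variable G : groupType.

Section Actions.
Variables (V : choiceType) (e : rel V) (act : G -> V -> V).

Definition graph_action : Prop :=
  [/\ forall x, act 1 x = x,
      forall g h x, act (g * h) x = act g (act h x) &
      forall g x y, e (act g x) (act g y) = e x y].

Definition vertex_stabiliser (x : V) : set G := [set g | act g x = x].

(* Setwise: an element swapping the two endpoints stabilises the edge. *)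
Definition edge_stabiliser (E : set V) : set G := [set g | act g @` E = E].

Definition edge_orbit (E : set V) : set (set V) :=
  [set act g @` E | g in [set: G]].

End Actions.

Definition peripheral_subgroups k (H : 'I_k -> set G) : set (set G) :=
  [set A | exists g i, A = conj_set g (H i)].

Definition relatively_hyperbolic k (H : 'I_k -> set G) : Prop :=
  exists (V : choiceType) (e : rel V) (act : G -> V -> V),
  [/\ simple_graph e, connected_graph e & graph_action e act] /\
  [/\ gromov_hyperbolic e /\ fine e,
      finite_set [set edge_orbit act E | E in edges e],
      forall E, edges e E -> finite_set (edge_stabiliser act E),
      [set A | infinite_set A /\ exists x, A = vertex_stabiliser act x]
        = peripheral_subgroups H &
      forall i, finitely_generated (H i)].

Definition maximal_nonperipheral_vc k (H : 'I_k -> set G) : set (set G) :=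
  [set A | maximal_infinite_vc A /\
           forall g i, ~ A `<=` conj_set g (H i)].

End RelativelyHyperbolic.

(* Main.v *)
Require Import Defs.
From mathcomp Require Import all_boot.
From mathcomp Require Import boolp classical_sets functions cardinality.
From mathcomp Require Import finmap zify.
Set Implicit Arguments.
Unset Strict Implicit.
Unset Printing Implicit Defensive.
Local Open Scope classical_set_scope.

(** Let the group act on the fine hyperbolic graph, so that the peripheral
    subgroups are the infinite vertex stabilisers.  The whole statement comes
    down to two facts about the action.

    The first is that distinct vertices [x] and [y] have stabilisers with
    finite intersection ([stabilisers_inter]).  Take a walk from [x] to [y]
    that leaves [x] for good at its first step [u].  Its translates by elements
    fixing [x] and [y] join [u] to [g u] outside [x], so the edges [xu] and
    [x(gu)] coincide or lie in a common circuit of bounded length.  Fineness leaves finitely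
    many values for [g u], and edge stabilisers are finite.  This settles the
    conditions on peripheral subgroups, and it shows that an infinite virtually
    cyclic group is contained in a vertex stabiliser as soon as it meets it in
    an infinite set ([infinite_vc_sub_stabiliser]).

    The second concerns an element [c] no positive power of which fixes a
    vertex.  Its elementary closure [E(c)] consists of the [g] that conjugate
    some positive power of [c] to itself or to its inverse.  It contains every
    infinite virtually cyclic group through [c], and even the normaliser of
    such a group ([normaliser_sub_elementary]).  If [E(c)] is itself virtually
    cyclic, it is therefore the unique maximal one through [c], equal to its own
    normaliser, and the nonperipheral members of the collection are exactly
    these groups [E(c)] ([maximal_nonperipheralP]).  All the conditions follow.

    It remains to see that [c] generates a subgroup of finite index in [E(c)]
    ([elementary_finite_index]); up to index two, [E(c)] is the increasing union
    of the centralisers of the positive powers of [c].  The proof is a count.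
    Fix a vertex [x] and let [h] commute with a power [b] of [c] and move [x] by
    at most [D].  Orbits of [b] are unbounded ([free_unbounded]), so there is a
    long geodesic from [x] to some [b^m x]; since [h] commutes with [b], it
    moves both ends by at most [D].  Slim triangles make the translate follow
    the geodesic away from the ends, and if [E] is an edge at distance
    comparable to [D] from [x], then the translate has an edge in a common
    circuit of bounded length with [E], or equal to [E] ([fellow_travel]).
    This edge is the image under [h] of one of O(D) edges of the geodesic, and
    it has boundedly many positions by fineness and finiteness of the number of
    edge orbits; the two edges determine [h] up to an edge stabiliser.  Hence
    there are at most [A D + B] such [h], with [A] and [B] independent of the
    power [b] ([centraliser_linear_growth]).  On the other hand [M] cosets of
    the group generated by [c] contain [M n] elements [g c^i], [i < n],
    that move [x] by at most [n d(x, c x) + O(1)].  Letting [n] grow gives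
    [M <= A d(x, c x)], whatever power of [c] the representatives commute
    with. *)

(** * Explicit bounds on finite sets *)

Section Counting.

(** Phrased with duplicate-free lists rather than cardinals, so that the bound
    makes sense for sets not yet known to be finite and can be made uniform over
    infinite families of sets. *)
Definition at_most (T : eqType) (A : set T) (n : nat) : Prop :=
  forall s, uniq s -> (forall x, x \in s -> A x) -> size s <= n.

Lemma finite_at_most (T : eqType) (A : set T) :
  finite_set A -> exists n, at_most A n.
Proof.
case/finite_seqP=> s ->; exists (size s) => t Ut ts.
by apply: uniq_leq_size => // x /ts.
Qed.

Lemma at_most_finite (T : choiceType) (A : set T) n :
  at_most A n -> finite_set A.
Proof.
move=> An; apply: contrapT => /(infinite_set_fset n.+1)[B BA].
by rewrite leqNgt ltnS An //; exact: fset_uniq.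
Qed.

Lemma at_most_fibres (T U : eqType) (R : T -> U -> Prop) n (r : seq U) :
  (forall u, at_most [set x | R x u] n) ->
  at_most [set x | exists2 u, u \in r & R x u] (size r * n).
Proof.
move=> Rn; elim: r => [|u r IHr] s Us sR.
  by case: s sR {Us} => //= x s /(_ x (mem_head _ _))[].
rewrite -(count_predC (fun x => `[< R x u >]) s) -!size_filter mulSn.
apply: leq_add.
  by apply: (Rn u) => [|x]; rewrite ?filter_uniq // mem_filter => /andP[/asboolP].
apply: IHr => [|x]; rewrite ?filter_uniq // mem_filter => /andP[/= /asboolPn nR].
case/sR=> v; rewrite inE => /orP[/eqP-> //|vr Rxv]; by exists v.
Qed.

(** How a statement that holds for finitely many objects, each with its own
    constant, acquires a common constant: edge orbits, vertices of a path and
    coset representatives are all treated in this way. *)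
Lemma finite_uniform (T : eqType) (S : set T) (Q : T -> nat -> Prop) :
  finite_set S -> (forall x m n, m <= n -> Q x m -> Q x n) ->
  (forall x, S x -> exists n, Q x n) -> exists n, forall x, S x -> Q x n.
Proof.
case/finite_seqP=> s -> Qmono; elim: s => [|x s IHs] Qs; first by exists 0.
have [m Qm] := Qs x (mem_head _ _).
have [|n Qn] := IHs; first by move=> y ys; apply: Qs; rewrite /= inE ys orbT.
exists (maxn m n) => y; rewrite /= inE => /orP[/eqP->|ys].
  exact: Qmono (leq_maxl _ _) Qm.
exact: Qmono (leq_maxr _ _) (Qn y ys).
Qed.

Lemma infinite_collision (T U : Type) (A : set T) (f : T -> U) :
  infinite_set A -> finite_set (f @` A) ->
  exists x y, [/\ A x, A y, x <> y & f x = f y].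
Proof.
move=> Ainf fA; apply: contrapT => inj; apply: Ainf.
have finj : {in A &, injective f}.
  move=> x y /set_mem Ax /set_mem Ay fxy; apply: contrapT => xy.
  by apply: inj; exists x, y.
by rewrite -(eq_finite_set (inj_card_eq finj)).
Qed.

End Counting.

(** * Powers, cosets and elementary closures *)

Section Groups.
Variable G : groupType.
Local Open Scope group_scope.
Implicit Types (A B C N V : set G) (c g x y : G).

(** A generator of an infinite cyclic group is only determined up to
    inversion; working modulo this ambiguity lets natural exponents suffice
    throughout. *)
Definition eqVinv x y := y = x \/ y = x^-1.

Lemma eqVinv_sym x y : eqVinv x y -> eqVinv y x.
Proof. by case=> ->; [left | right; rewrite invgK]. Qed.

Lemma eqVinv_trans x y z : eqVinv x y -> eqVinv y z -> eqVinv x z.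
Proof.
by case=> -> [] ->; [left | right | right | left]; rewrite ?invgK.
Qed.

Lemma eqVinvX n x y : eqVinv x y -> eqVinv (x ^+ n) (y ^+ n).
Proof. by case=> ->; [left | right; rewrite expVgn]. Qed.

Lemma eqVinvJ g x y : eqVinv x y -> eqVinv (x ^ g) (y ^ g).
Proof. by case=> ->; [left | right; rewrite conjVg]. Qed.

Lemma subgroupX A x n : is_subgroup A -> A x -> A (x ^+ n).
Proof.
by case=> A1 AM _ Ax; elim: n => [|n IHn]; rewrite ?expg0 // expgS; apply: AM.
Qed.

Lemma subgroup_eqVinv A x y : is_subgroup A -> eqVinv x y -> A x -> A y.
Proof. by case=> _ _ AV [] -> // /AV. Qed.

Lemma is_subgroupI A B : is_subgroup A -> is_subgroup B -> is_subgroup (A `&` B).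
Proof.
case=> A1 AM AV [B1 BM BV]; split=> [|x y [Ax Bx] [Ay By]|x [Ax Bx]]; split; auto.
Qed.

Definition infinite_order c := forall n, 0 < n -> c ^+ n <> 1.

Lemma infinite_order_inj c m n : infinite_order c -> c ^+ m = c ^+ n -> m = n.
Proof.
move=> oo; wlog le_mn : m n / m <= n => [wl e|].
  by case/orP: (leq_total m n) => le; [apply: wl | symmetry; apply: wl].
move=> e; move: le_mn; rewrite leq_eqVlt => /orP[/eqP //|lt_mn].
case: (oo (n - m)); first by rewrite subn_gt0.
by rewrite expgnFr ?(ltnW lt_mn) // e mulgV.
Qed.

Lemma infinite_order_eqVinv c m n : infinite_order c -> eqVinv (c ^+ m) (c ^+ n) -> m = n.
Proof.
move=> oo [/(infinite_order_inj oo)-> //|e].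
have : c ^+ (n + m) = 1 by rewrite expgnDr e mulVg.
case: n m {e} => [|n] [|m] // e; by case: (oo _ _ e).
Qed.

Lemma infinite_orderX c n : 0 < n -> infinite_order c -> infinite_order (c ^+ n).
Proof. by move=> n0 oo m m0; rewrite -expgnA; apply: oo; rewrite muln_gt0 n0. Qed.

Definition powers c : set G := [set x | exists n, eqVinv (c ^+ n) x].

Lemma powersB c m n : powers c (c ^+ m * c ^- n).
Proof.
case/orP: (leq_total m n) => le; last by exists (m - n); left; rewrite expgnFr.
by exists (n - m); right; rewrite expgnFr // invgM invgK.
Qed.

Lemma powers_subgroup c : is_subgroup (powers c).
Proof.
split=> [|x y [m xm] [n yn]|x [n xn]]; first by exists 0; left.
  have cmn : commute (c ^+ m) (c ^+ n) by exact: commuteX2.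
  case: xm yn => -> [] ->.
  - by exists (m + n); left; rewrite expgnDr.
  - exact: powersB.
  - rewrite -(commuteV (commute_sym cmn)); exact: powersB.
  - by exists (m + n); right; rewrite -invgM -expgnDr addnC.
by exists n; apply: eqVinv_trans xn _; right.
Qed.

Lemma generated1E c : generated [set c] = powers c.
Proof.
apply/seteqP; split.
  apply: smallest_sub; first exact: powers_subgroup.
  by move=> _ ->; exists 1%N; left; rewrite expg1.
move=> x [n xn] B [Bs /(_ c erefl) Bc].
by apply: subgroup_eqVinv xn _ => //; apply: subgroupX.
Qed.

Lemma left_cosetP C x y : is_subgroup C ->
  left_coset x C = left_coset y C <-> C (x^-1 * y).
Proof.
case=> C1 CM CV; split=> [e|Cxy].
  have: left_coset y C y by exists 1 => //; rewrite mulg1.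
  by rewrite -e => -[z Cz <-]; rewrite mulKg.
apply/seteqP; split=> _ [z Cz <-].
  exists (y^-1 * x * z); last by rewrite !mulgA mulgV mul1g.
  by apply: CM => //; have /CV := Cxy; rewrite invgM invgK.
exists (x^-1 * y * z); last by rewrite !mulgA mulgV mul1g.
exact: CM.
Qed.

Lemma infinite_powers A c : infinite_order c -> is_subgroup A -> A c -> infinite_set A.
Proof.
move=> oo As Ac fA; apply: infinite_nat.
have inj : {in [set: nat] &, injective (fun n => c ^+ n)}.
  by move=> m n _ _; apply: infinite_order_inj.
rewrite -(eq_finite_set (inj_card_eq inj)).
by apply: sub_finite_set fA => _ [n _ <-]; apply: subgroupX.
Qed.

(** A finite cyclic subgroup of finite index would make [V] finite, so the
    generator has infinite order. *)
Lemma infinite_vcP V : infinite_vc V <->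
  is_subgroup V /\ exists2 c, infinite_order c & finite_index (powers c) V.
Proof.
split=> [[[Vs [_ [c ->] [CV fC]]] Vinf]|[Vs [c oo fC]]]; last first.
  have Vc : V c by case: fC => CV _; apply: CV; exists 1%N; left; rewrite expg1.
  split; last exact: infinite_powers oo Vs Vc.
  split=> //; exists (generated [set c]); first by exists c.
  by rewrite generated1E.
split=> //; exists c; last by rewrite -generated1E.
rewrite generated1E in CV fC.
move=> n n0 cn1; apply: Vinf.
have fP : finite_set (powers c).
  apply: (@sub_finite_set _ _ ((fun i => c ^+ i) @` `I_n `|`
                               (fun i => c ^- i) @` `I_n)).
    move=> x [m xm].
    have cm : c ^+ m = c ^+ (m %% n).
      by rewrite {1}(divn_eq m n) expgnDr mulnC expgnA cn1 expg1n mul1g.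
    by case: xm => ->; [left | right]; rewrite cm; exists (m %% n) => //=;
      rewrite ltn_mod.
  by rewrite finite_setU; split; apply: finite_image; apply: finite_II.
apply: (@sub_finite_set _ _ (\bigcup_(B in [set left_coset g (powers c) | g in V]) B)).
  move=> x Vx; exists (left_coset x (powers c)); first by exists x.
  by exists 1; rewrite ?mulg1 //; exists 0; left.
apply: bigcup_finite => // _ [g _ <-]; exact: finite_image.
Qed.

Lemma finite_index_collision V c B : finite_index (powers c) V ->
  B `<=` V -> infinite_set B -> exists x y, [/\ B x, B y, x <> y & powers c (x^-1 * y)].
Proof.
move=> [_ fC] BV Binf.
have [|x [y [Bx By xy e]]] :=
  infinite_collision (f := fun g => left_coset g (powers c)) Binf.
  by apply: sub_finite_set fC => _ [x Bx <-]; exists x => //; apply: BV.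
by exists x, y; split=> //; apply/(left_cosetP _ _ (powers_subgroup c)).
Qed.

Lemma infinite_subgroup_power V c A : finite_index (powers c) V ->
  is_subgroup A -> A `<=` V -> infinite_set A ->
  exists2 n, 0 < n & A (c ^+ n).
Proof.
move=> fC As AV Ainf.
have [x [y [Ax Ay xy [[|n] xyn]]]] := finite_index_collision fC AV Ainf.
  case: xy; rewrite -[y](mulVKg x).
  by case: xyn => ->; rewrite expg0 ?invg1 mulg1.
exists n.+1 => //; apply: subgroup_eqVinv (eqVinv_sym xyn) _ => //.
by case: As => _ AM AV'; apply: AM => //; apply: AV'.
Qed.

(** With [m] cosets, two of [1, x, ..., x^m] lie in the same one, so some power
    of [x] with exponent at most [m] is a power of [c]; [m!] works for all [x]
    at once. *)
Lemma finite_index_exponent V c : is_subgroup V -> finite_index (powers c) V ->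
  exists2 M, 0 < M & forall x, V x -> powers c (x ^+ M).
Proof.
move=> Vs [_ fC]; have [m Cm] := finite_at_most fC.
exists m`! => [|x Vx]; first exact: fact_gt0.
pose f i := left_coset (x ^+ i) (powers c).
have : ~~ uniq [seq f i | i <- iota 0 m.+1].
  apply/negP => /Cm; rewrite size_map size_iota ltnn.
  have VX B : B \in [seq f i | i <- iota 0 m.+1] ->
      [set left_coset g (powers c) | g in V] B.
    by case/mapP=> i _ ->; exists (x ^+ i) => //; apply: subgroupX.
  by move=> /(_ VX).
case/(uniqPn (f 0)) => i [j []]; rewrite size_map size_iota => lt_ij lt_jm.
rewrite !(nth_map 0) ?size_iota ?(ltn_trans lt_ij) //.
rewrite !nth_iota ?(ltn_trans lt_ij) // !add0n.
move/(left_cosetP _ _ (powers_subgroup c)) => Cij.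
have {Cij}Ck : powers c (x ^+ (j - i)).
  by rewrite -(subnKC (ltnW lt_ij)) expgnDr mulKg in Cij.
have /dvdnP[q ->] : j - i %| m`! by apply: dvdn_fact; lia.
by rewrite mulnC expgnA; apply: subgroupX Ck; apply: powers_subgroup.
Qed.

Lemma conj_setE g A x : conj_set g A x <-> A (x ^ g).
Proof.
split=> [[a Aa <-]|Ax]; first by rewrite conjgE mulgVK mulKg.
by exists (x ^ g) => //; rewrite conjgE !mulgA mulgV mul1g mulgK.
Qed.

Lemma normaliserP g A : normaliser A g <-> forall x, A (x ^ g) <-> A x.
Proof.
split=> [NA x|NA]; first by rewrite -{2}NA conj_setE.
by apply/seteqP; split=> x; rewrite conj_setE NA.
Qed.

Lemma normaliser_subgroup A : is_subgroup (normaliser A).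
Proof.
split=> [|g h /normaliserP Ng /normaliserP Nh|g /normaliserP Ng]; apply/normaliserP => x.
- by rewrite conjg1.
- by rewrite conjgM Nh Ng.
- by rewrite -Ng conjgKV.
Qed.

Lemma sub_normaliser A : is_subgroup A -> A `<=` normaliser A.
Proof.
case=> A1 AM AV g Ag; apply/normaliserP => x; split=> [Axg|Ax].
  by rewrite -(conjgK g x) conjgE invgK; apply: (AM) => //; apply: (AM) => //; apply: AV.
by rewrite conjgE; apply: (AM); [apply: AV | apply: AM].
Qed.

(** For a loxodromic [c] this is the stabiliser of the pair of its endpoints
    on the boundary; the algebraic description avoids the boundary. *)
Definition elementary c : set G :=
  [set g | exists2 p, 0 < p & eqVinv (c ^+ p) ((c ^+ p) ^ g)].

Lemma elementary_subgroup c : is_subgroup (elementary c).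
Proof.
split=> [|g h [p p0 gp] [q q0 hq]|g [p p0 gp]].
- by exists 1%N => //; left; rewrite conjg1.
- exists (p * q)%N; first by rewrite muln_gt0 p0.
  have e1 := eqVinvX q gp; have e2 := eqVinvX p hq.
  rewrite -conjXg -expgnA in e1; rewrite -conjXg -expgnA mulnC in e2.
  by apply: eqVinv_trans e2 _; rewrite conjgM; apply: eqVinvJ.
- exists p => //; apply: eqVinv_sym; have := eqVinvJ g^-1 gp.
  by rewrite conjgK.
Qed.

(** The elementary closure depends only on the commensurability class of
    [c]. *)
Lemma elementary_commens c d m n : 0 < m -> 0 < n -> eqVinv (c ^+ m) (d ^+ n) ->
  elementary c `<=` elementary d.
Proof.
move=> m0 n0 e g [p p0 gp]; exists (n * p)%N; first by rewrite muln_gt0 n0.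
have {}e := eqVinvX p e; rewrite -!expgnA in e.
have := eqVinvX m gp; rewrite -conjXg -expgnA mulnC => {}gp.
exact: eqVinv_trans (eqVinv_trans (eqVinv_sym e) gp) (eqVinvJ g e).
Qed.

Lemma elementary_commensE c d m n : 0 < m -> 0 < n -> eqVinv (c ^+ m) (d ^+ n) ->
  elementary c = elementary d.
Proof.
by move=> m0 n0 e; apply/seteqP; split; [|move/eqVinv_sym in e];
   apply: elementary_commens e.
Qed.

Lemma mem_elementary c : elementary c c.
Proof. by exists 1%N => //; left; rewrite conjgE expg1 mulKg. Qed.

Lemma conj_elementary c g : conj_set g (elementary c) = elementary (c ^ g^-1).
Proof.
apply/seteqP; split=> x.
  move/conj_setE => [p p0 xp]; exists p => //.
  by have := eqVinvJ g^-1 xp; rewrite conjJg conjgK conjXg.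
case=> p p0 xp; apply/conj_setE; exists p => //.
by have := eqVinvJ g xp; rewrite conjJg conjXg conjgKV.
Qed.

(** By commensurability [c] may be replaced by a generator [d] of a cyclic
    subgroup of finite index.  Let [M] be an exponent carrying [V] into the
    powers of [d].  Each [g] in the normaliser conjugates
    [d^M] to a power [d^n] up to sign, and [n = M] has to be shown.  Let [s] be
    the least exponent that occurs, for [g0] say.  Conjugating by [g0 g] gives
    an exponent [n'] with [n s = n' M], and [n' >= s] forces [n >= M].  So every
    exponent is at least [M]; the exponents of [g] and of [g^-1] have product
    [M * M], hence both equal [M]. *)
Lemma normaliser_sub_elementary V c : infinite_vc V -> V c -> infinite_order c ->
  normaliser V `<=` elementary c.
Proof.
move=> /infinite_vcP[Vs [d ood fD]] Vc ooc.
have [M M0 VM] := finite_index_exponent Vs fD.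
have Vd : V d by case: fD => DV _; apply: DV; exists 1%N; left; rewrite expg1.
have [N1 NM NV] := normaliser_subgroup V.
have [k cd] := VM c Vc.
have k0 : 0 < k.
  by case: k cd => // -[] e; case: (ooc M); rewrite // e ?expg0 ?invg1.
rewrite (elementary_commensE M0 k0 (eqVinv_sym cd)) => {c Vc ooc k k0 cd}.
have expo g : normaliser V g -> exists n, eqVinv (d ^+ n) ((d ^+ M) ^ g).
  by move=> /normaliserP NgV; rewrite conjXg; apply: VM; apply/NgV.
pose P n := `[< exists2 g, normaliser V g & eqVinv (d ^+ n) ((d ^+ M) ^ g) >].
have exP : exists n, P n by have [n e] := expo 1 N1; exists n; apply/asboolP; exists 1.
case: (ex_minnP exP) => s /asboolP[g0 Ng0 g0s] min.
have s0 : 0 < s.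
  case: s g0s {min} => // e; case: (ood M) => //; apply: (@conjg_inj _ g0).
  by rewrite conj1g; case: e => ->; rewrite ?expg0 ?invg1.
have geM g n : normaliser V g -> eqVinv (d ^+ n) ((d ^+ M) ^ g) -> M <= n.
  move=> Ng gn; have [n' gn'] := expo _ (NM _ _ Ng0 Ng).
  have le_sn' : s <= n' by apply: min; apply/asboolP; exists (g0 * g) => //; apply: NM.
  have e : (n * s = n' * M)%N.
    apply: (infinite_order_eqVinv ood); have e1 := eqVinvX s gn; have e2 := eqVinvX M gn'.
    rewrite -expgnA in e1; rewrite -expgnA in e2.
    apply: eqVinv_trans e1 _; apply: eqVinv_trans _ (eqVinv_sym e2).
    rewrite conjgM -2!(conjXg _ g) expgnAC.
    exact: eqVinvJ (eqVinvX M g0s).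
  by rewrite -(leq_pmul2r s0) e mulnC leq_pmul2r.
move=> g Ng; have [n gn] := expo _ Ng; have [n' gn'] := expo _ (NV _ Ng).
have e : (n * n' = M * M)%N.
  apply: (infinite_order_eqVinv ood).
  have e1 := eqVinvX n gn'; have e2 := eqVinvX M (eqVinvJ g^-1 gn).
  rewrite conjgK -!conjXg -!expgnA in e1 e2.
  by apply: eqVinv_trans e2; rewrite mulnC (mulnC n M) in e1 *.
have en : n = M.
  have := geM _ _ Ng gn; have := geM _ _ (NV _ Ng) gn'; nia.
by exists M => //; rewrite {1}en in gn.
Qed.

End Groups.

(** * Walks of bounded length *)

Section Walks.
Variable V : choiceType.
Implicit Types (r : rel V) (x y z : V).

Definition near r x y n := exists2 s, path_between r x y s & size s <= n.

Lemma near_refl r x n : near r x x n.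
Proof. by exists [::]. Qed.

Lemma near1 r x y : r x y -> near r x y 1.
Proof. by move=> rxy; exists [:: y]; rewrite //; split; rewrite //= rxy. Qed.

Lemma near_leq r x y m n : m <= n -> near r x y m -> near r x y n.
Proof. by move=> mn [s ? sm]; exists s => //; apply: leq_trans mn. Qed.

Lemma near_trans r x y z m n : near r x y m -> near r y z n -> near r x z (m + n).
Proof.
move=> [s [ps ls] sm] [t [pt lt] tn]; exists (s ++ t); last by rewrite size_cat leq_add.
by split; rewrite ?cat_path ?last_cat ls // ps.
Qed.

Lemma near_sym r x y n : symmetric r -> near r x y n -> near r y x n.
Proof.
move=> sr [s [ps <-] sn]; exists (rev (belast x s)); last by rewrite size_rev size_belast.
split; first by rewrite rev_path; rewrite (eq_path (e' := r)) // => u v; rewrite sr.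
by case: s {ps sn} => //= y' s; rewrite rev_cons last_rcons.
Qed.

Lemma near_sub r r' x y n : subrel r r' -> near r x y n -> near r' x y n.
Proof. by move=> rr' [s [ps ls] sn]; exists s => //; split=> //; apply: sub_path ps. Qed.

Lemma near_simple r x y n : near r x y n ->
  exists2 s, path_between r x y s & uniq (x :: s) /\ size s <= n.
Proof.
move=> [s [ps ls] sn]; move: ls; case/shortenP: ps => t pt Ut ts <-.
exists t => //; split=> //; apply: leq_trans sn; apply: uniq_leq_size => //.
by case/andP: Ut.
Qed.

Lemma near_walk r (f : nat -> V) i n :
  (forall k, i <= k < i + n -> r (f k) (f k.+1)) -> near r (f i) (f (i + n)) n.
Proof.
elim: n => [|n IHn] rf; first by rewrite addn0; apply: near_refl.
rewrite addnS -[n.+1]addn1; apply: near_trans (IHn _) (near1 (rf _ _)); last by lia.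
by move=> k ?; apply: rf; lia.
Qed.

Definition off (e : rel V) v : rel V := fun s t => [&& e s t, s != v & t != v].

Lemma off_sym (e : rel V) v : symmetric e -> symmetric (off e v).
Proof. by move=> se x y; rewrite /off se; congr andb; rewrite andbC. Qed.

Lemma path_off (e : rel V) v x s : path (off e v) x s -> x != v -> v \notin x :: s.
Proof.
elim: s x => [|y s IHs] x /= => [_|]; first by rewrite inE eq_sym.
case/andP=> /and3P[_ xv yv] ps _.
by rewrite inE negb_or eq_sym xv; apply: IHs.
Qed.

End Walks.

Lemma near_map (V V' : choiceType) (r : rel V) (r' : rel V') (f : V -> V') x y n :
  (forall s t, r s t -> r' (f s) (f t)) -> near r x y n -> near r' (f x) (f y) n.
Proof.
move=> rr' [s [ps ls] sn]; exists (map f s); rewrite ?size_map //.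
split; last by rewrite last_map ls.
by rewrite path_map; apply: sub_path ps.
Qed.

(** * The graph metric and circuits through an edge *)

Section Distance.
Variables (V : choiceType) (e : rel V).
Hypotheses (sg : simple_graph e) (cg : connected_graph e).
Implicit Types (x y z v w : V).

Let e_sym : symmetric e. Proof. by case: sg. Qed.

Lemma near_ex x y : exists n, `[< near e x y n >].
Proof.
by case: cg => _ /(_ x y)[s ps ls]; exists (size s); apply/asboolP; exists s.
Qed.

Definition dist x y := ex_minn (near_ex x y).

Lemma dist_near x y n : near e x y n <-> dist x y <= n.
Proof.
rewrite /dist; case: ex_minnP => m /asboolP xym min; split=> [xyn|mn].
  by apply: min; apply/asboolP.
exact: near_leq xym.
Qed.

Lemma distxx x : dist x x = 0.
Proof. by apply/eqP; rewrite -leqn0; apply/dist_near/near_refl. Qed.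

Lemma dist_eq0 x y : dist x y <= 0 -> x = y.
Proof. by move=> /dist_near[[|? ?] [_ //]]. Qed.

Lemma dist_sym x y : dist x y = dist y x.
Proof.
by apply/eqP; rewrite eqn_leq; apply/andP; split; apply/dist_near/near_sym/dist_near.
Qed.

Lemma dist_triangle y x z : dist x z <= dist x y + dist y z.
Proof. by apply/dist_near/(@near_trans _ _ _ y); apply/dist_near. Qed.

Lemma dist_edge x y : e x y -> dist x y <= 1.
Proof. by move=> exy; apply/dist_near/near1. Qed.

Lemma dist_step x y n : dist x y = n.+1 -> exists2 u, e x u & dist u y <= n.
Proof.
move=> d; have /dist_near[s [ps ls] sn] : dist x y <= n.+1 by rewrite d.
case: s ps ls sn => [_ /= xy|u s /= /andP[exu ps] ls sn].
  by rewrite xy distxx in d.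
by exists u => //; apply/dist_near; exists s.
Qed.

Definition in_ball z k : rel V := fun s t => [&& e s t, dist s z <= k & dist t z <= k].

Lemma in_ball_sym z k : symmetric (in_ball z k).
Proof. by move=> x y; rewrite /in_ball e_sym; congr andb; rewrite andbC. Qed.

(** A shortest walk to [z] never moves away from [z].  In this way walks are
    kept inside a ball, and off any vertex outside that ball. *)
Lemma near_in_ball x z k : dist x z <= k -> near (in_ball z k) x z k.
Proof.
move/dist_near => [s [ps ls] sk]; exists s => //; split=> //.
elim: s x ps ls sk => //= y s IHs x /andP[exy ps] ls sk.
have yz : dist y z <= size s by apply/dist_near; exists s.
rewrite /in_ball exy IHs ?(ltnW sk) // andbT (leq_trans yz (ltnW sk)) andbT.
by have := dist_triangle y x z; have := dist_edge exy; lia.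
Qed.

Lemma near_off_ball x z v k : dist x z <= k -> k < dist v z -> near (off e v) x z k.
Proof.
move=> xz vz; apply: near_sub (near_in_ball xz) => s t /and3P[est sz tz].
by rewrite /off est /=; apply/andP; split; apply/negP => /eqP E;
   rewrite -E ltnNge ?sz ?tz in vz.
Qed.

(** A geodesic never returns to its origin. *)
Lemma first_step v y : v <> y -> exists2 u, e v u & near (off e v) u y (dist v y).-1.
Proof.
move=> vy; case E : (dist v y) => [|n]; first by case: vy; apply: dist_eq0; rewrite E.
by have [u evu uy] := dist_step E; exists u => //; apply: near_off_ball; rewrite ?E.
Qed.

Lemma dist_path x s w : path e x s -> w \in x :: s -> dist x w <= size s.
Proof.
move=> ps ws; move: ps; case/splitPl: ws => t u lt.
rewrite cat_path size_cat => /andP[pt _].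
by apply: leq_trans (leq_addr _ _); apply/dist_near; exists t.
Qed.

(** The edge itself is included because the arguments below produce either a
    short circuit through [E] or a degenerate one in which the second edge
    coincides with [E]. *)
Definition circuit_nbhd n (E : set V) : set V :=
  E `|` [set w | exists2 c,
    [/\ circuit e c, size c <= n & circuit_contains c E] & w \in c].

Lemma finite_circuit_nbhd n E : fine e -> edges e E -> finite_set (circuit_nbhd n E).
Proof.
move=> fe EE; rewrite finite_setU; split.
  by case: EE => x [y [_ ->]]; apply: finite_set2.
pose C k := [set c | [/\ circuit e c, size c = k & circuit_contains c E]].
apply: (@sub_finite_set _ _ (\bigcup_(k in `I_n.+1) \bigcup_(c in C k) [set` c])).
  by move=> w [c [cc cn cE] wc]; exists (size c) => //; exists c.
apply: bigcup_finite => [|k _]; first exact: finite_II.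
by apply: bigcup_finite => [|c _]; [apply: fe | apply: finite_seq].
Qed.

Lemma simple_path_circuit_nbhd n a b s w :
  e a b -> path e a s -> last a s = b -> uniq (a :: s) -> 1 < size s -> size s < n ->
  w \in a :: s -> circuit_nbhd n [set a; b] w.
Proof.
move=> eab ps ls Us s1 sn ws; right; exists (a :: s) => //; split=> //.
  split=> //; rewrite /ucycle Us andbT /= rcons_path ps ls.
  by rewrite e_sym.
exists b; first by rewrite -ls mem_last.
rewrite next_nth -ls mem_last index_last // nth_default // setUC //.
Qed.

(** Fineness is used at a vertex in this form: seen from [v], only finitely many
    neighbours [a] of [v] can be joined to a given neighbour [u] by a walk of
    bounded length that avoids [v], since such a walk closes up to a
    circuit. *)
Lemma off_circuit_nbhd n v u a : e v u -> e v a -> near (off e v) a u n ->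
  circuit_nbhd n.+2 [set v; u] a.
Proof.
move=> evu eva /near_simple[s [ps ls] [Us sn]].
have av : a != v by apply/eqP => E; case: sg => _ /(_ v); rewrite -{2}E eva.
case: s ps ls Us sn => [|t s] ps ls Us sn; first by left; right.
apply: (@simple_path_circuit_nbhd _ _ _ (a :: t :: s)) => //.
- have offe : subrel (off e v) e by move=> ? ? /and3P[].
  by have /= -> := sub_path offe ps; rewrite eva.
- by rewrite cons_uniq Us (path_off ps).
- by rewrite !inE eqxx orbT.
Qed.

End Distance.

(** * Actions on fine graphs *)

Section Action.
Variables (G : groupType) (V : choiceType) (e : rel V) (act : G -> V -> V).
Hypotheses (sg : simple_graph e) (cg : connected_graph e) (ga : graph_action e act).
Hypotheses (fe : fine e)
  (fs : forall E, edges e E -> finite_set (edge_stabiliser act E)).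
Local Open Scope group_scope.
Implicit Types (g h c : G) (x y z v w : V).

Let e_sym : symmetric e. Proof. by case: sg. Qed.
Let d := dist cg.

Lemma act1 x : act 1 x = x. Proof. by case: ga. Qed.
Lemma actM g h x : act (g * h) x = act g (act h x). Proof. by case: ga. Qed.
Lemma act_edge g x y : e (act g x) (act g y) = e x y. Proof. by case: ga. Qed.
Lemma actK g : cancel (act g) (act g^-1).
Proof. by move=> x; rewrite -actM mulVg act1. Qed.
Lemma actVK g : cancel (act g^-1) (act g).
Proof. by move=> x; rewrite -actM mulgV act1. Qed.

Lemma dist_act g x y : d (act g x) (act g y) = d x y.
Proof.
have le h u v : d (act h u) (act h v) <= d u v.
  apply/dist_near; apply: (@near_map _ _ e) => [s t|]; first by rewrite act_edge.
  exact/dist_near.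
by apply/eqP; rewrite eqn_leq le -{1}(actK g x) -{1}(actK g y) le.
Qed.

Lemma stabiliser_subgroup x : is_subgroup (vertex_stabiliser act x).
Proof.
rewrite /vertex_stabiliser; split=> /= [|g h gx hx|g gx]; first exact: act1.
  by rewrite actM hx.
by rewrite -{1}gx actK.
Qed.

Lemma conj_stabiliser g x :
  conj_set g (vertex_stabiliser act x) = vertex_stabiliser act (act g x).
Proof.
apply/seteqP; split=> h.
  move/conj_setE; rewrite /vertex_stabiliser /= conjgE !actM.
  by move=> /(congr1 (act g)); rewrite actVK.
move=> hx; apply/conj_setE; rewrite /vertex_stabiliser /= in hx *.
by rewrite conjgE !actM hx actK.
Qed.

(** If there is such an element at all, they form a coset of the pointwise
    stabiliser of [x] and [y], which lies in the edge stabiliser. *)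
Lemma edge_transporter_at_most n x y x' y' :
  at_most (edge_stabiliser act [set x; y]) n ->
  at_most [set h | act h x = x' /\ act h y = y'] n.
Proof.
move=> En [//|h s] Us hs.
have [hx hy] := hs h (mem_head _ _).
rewrite -(size_map (fun g => h^-1 * g)); apply: En => [|_ /mapP[g gs ->]].
  by rewrite map_inj_uniq //; apply: mulgI.
have [gx gy] := hs g gs.
have fixx : act (h^-1 * g) x = x by rewrite actM gx -hx actK.
have fixy : act (h^-1 * g) y = y by rewrite actM gy -hy actK.
by rewrite /edge_stabiliser /= image_setU !image_set1 fixx fixy.
Qed.

Lemma stabilisers_inter x y : x <> y ->
  finite_set (vertex_stabiliser act x `&` vertex_stabiliser act y).
Proof.
move=> xy; have [u exu uy] := first_step cg xy.
set n := (dist cg x y).-1 in uy.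
have Exu : edges e [set x; u] by exists x, u.
have [r rE] := (finite_seqP _).1 (finite_circuit_nbhd (n + n).+2 fe Exu).
have [m Em] := finite_at_most (fs Exu).
have fib v : at_most [set h | act h x = x /\ act h u = v] m.
  exact: edge_transporter_at_most.
apply: at_most_finite; move: (at_most_fibres fib (r := r)) => bnd s Us sS.
apply: (bnd s Us) => h /sS[hx hy]; exists (act h u) => //.
suff : circuit_nbhd e (n + n).+2 [set x; u] (act h u) by rewrite rE.
rewrite /vertex_stabiliser /= in hx hy.
apply: off_circuit_nbhd => //; first by rewrite -{1}hx act_edge.
apply: (@near_trans _ _ _ y); last by apply: near_sym (off_sym _ e_sym) uy.
rewrite -hy; apply: near_map uy => s' t /and3P[est sx tx].
rewrite /off act_edge est /=.
by rewrite -{1}hx -{2}hx !(inj_eq (can_inj (actK h))) sx.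
Qed.

(** Such an element has infinite order; under the hypotheses of relative
    hyperbolicity these are the loxodromic elements. *)
Definition acts_freely c := forall q x, 0 < q -> act (c ^+ q) x <> x.

(** If some orbit is bounded, let [m] be least such that, for some [v] and [z],
    infinitely many [c^i z] are at distance at most [m] from [v].  Freeness
    gives [m > 0].  Minimality means that every vertex has almost all points of
    every sequence [c^i y] at distance at least [m].  For infinitely many [i] let
    [a] be the first vertex after [v] on a geodesic from [v] to [c^i z].  The
    walk from [a] to [c^i z], then along a translate of a fixed walk to [c^i (c z)], then back
    along the image under [c] of the first part to [c v], finally to a fixed
    neighbour [u] of [v], has bounded length and, for large [i], avoids [v].  So
    [a] ranges over a finite set by fineness.  But [a] is at distance less than
    [m] from [c^i z], which excludes all large [i]. *)
Lemma free_unbounded c x n : acts_freely c -> exists i, n < d x (act (c ^+ i) x).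
Proof.
move=> free; apply: contrapT => bnd.
pose freq v z m := forall N, exists2 i, N <= i & d v (act (c ^+ i) z) <= m.
have exf : exists m, `[< exists v z, freq v z m >].
  exists n; apply/asboolP; exists x, x => N; exists N => //.
  by rewrite leqNgt; apply/negP => lt; apply: bnd; exists N.
case: (ex_minnP exf) => m /asboolP[v [z vz]] min.
have rare w y : exists N, forall i, N <= i -> m <= d w (act (c ^+ i) y).
  apply: contrapT => nex.
  case: m min {vz} nex => [|m] min nex; first by apply: nex; exists 0.
  suff /asboolP/min : exists v z, freq v z m by rewrite ltnn.
  exists w, y => N; apply: contrapT => nN; apply: nex; exists N => i Ni.
  by rewrite ltnNge; apply/negP => le; apply: nN; exists i.
case: m vz {min} rare => [|k] vz rare.
  have [i _ /dist_eq0 vi] := vz 0; have [j ij /dist_eq0 vj] := vz i.+1.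
  case: (free (j - i) v); first by rewrite subn_gt0.
  by rewrite {1}vi -actM -expgnDr subnK ?(ltnW ij).
(* Uniform version of [rare], with [m] now written [k.+1]. *)
have rares (s : seq V) (f : V -> V * V) :
    exists N, forall w, w \in s -> forall i, N <= i ->
    k < d (f w).1 (act (c ^+ i) (f w).2).
  apply: (@finite_uniform _ [set` s]
    (fun w N => forall i, N <= i -> k < d (f w).1 (act (c ^+ i) (f w).2))).
  - exact: finite_seq.
  - by move=> w p q pq H i qi; apply: H; apply: leq_trans qi.
  - by move=> w _; apply: rare.
have cvv : v <> act c v by move/esym; rewrite -{1}(expg1 c); apply: free.
have [u evu ucv] := first_step cg cvv.
have [b [pb lb]] : exists2 b, path e z b & last z b = act c z by case: cg => _; apply.
pose len := k + (size b + (k + (1 + (dist cg v (act c v)).-1))).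
have Evu : edges e [set v; u] by exists v, u.
have [r rE] := (finite_seqP _).1 (finite_circuit_nbhd len.+2 fe Evu).
have [N1 far_b] := rares (z :: b) (fun w => (v, w)).
have [N2 far_r] := rares r (fun w => (w, z)).
have [i Ni vi] := vz (maxn N1 N2).
rewrite geq_max in Ni; case/andP: Ni => N1i N2i.
have dvz : k < d v (act (c ^+ i) z) by apply: far_b => //; apply: mem_head.
have dvcz : k < d v (act (c ^+ i) (act c z)).
  by apply: (far_b) => //; rewrite -lb mem_last.
have dvz_eq : d v (act (c ^+ i) z) = k.+1 by apply/eqP; rewrite eqn_leq vi.
have [a eva az] := dist_step dvz_eq.
suff ra : a \in r by have := far_r a ra i N2i; rewrite /= ltnNge az.
suff : circuit_nbhd e len.+2 [set v; u] a by rewrite rE.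
apply: off_circuit_nbhd => //.
apply: near_trans (near_off_ball az dvz) _.
(* [c] carries [c^i z] to [c^i (c z)]. *)
have cca : d (act c a) (act (c ^+ i) (act c z)) <= k.
  by rewrite -actM -expgSr expgS actM dist_act.
apply: near_trans; last first.
  apply: near_trans; first exact: near_sym (off_sym _ e_sym) (near_off_ball cca dvcz).
  apply: near_trans; last exact: near_sym (off_sym _ e_sym) ucv.
  apply: near1; rewrite /off act_edge e_sym eva /=; apply/andP; split.
    by apply/eqP => E; move: dvcz; rewrite -E ltnNge cca.
  by apply/eqP => E; apply: cvv.
exists (map (act (c ^+ i)) b); last by rewrite size_map.
split; last by rewrite last_map lb.
rewrite path_map.
apply: (@sub_in_path _ (fun w => act (c ^+ i) w != v)  e) pb.
  by move=> s t sv tv est; rewrite /off /= act_edge est /=; apply/andP; split.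
apply/allP => w wb; apply/eqP => E.
by have := far_b w wb i N1i; rewrite /= E /d distxx.
Qed.

End Action.

(** * Fellow-travelling geodesics in a slim graph *)

Section Geodesics.
Variables (V : choiceType) (e : rel V).
Hypotheses (sg : simple_graph e) (cg : connected_graph e).
Implicit Types (x y z v w : V) (p q : seq V).

Let e_sym : symmetric e. Proof. by case: sg. Qed.
Let d := dist cg.
Let dC x y : d x y = d y x. Proof. exact: dist_sym. Qed.
Let tri y x z : d x z <= d x y + d y z. Proof. exact: dist_triangle. Qed.

Lemma geodesicP x y p : geodesic e x y p <-> path_between e x y p /\ size p = d x y.
Proof.
split=> [[xyp min]|[xyp sp]]; split=> //.
  have [s xys ss] := (dist_near cg x y _).2 (leqnn _).
  apply/eqP; rewrite eqn_leq (leq_trans (min s xys) ss).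
  by apply/dist_near; exists p.
by move=> q xyq; rewrite sp; apply/dist_near; exists q.
Qed.

Lemma geodesic_ex x y : exists p, geodesic e x y p.
Proof.
have [s xys ss] := (dist_near cg x y _).2 (leqnn _).
exists s; apply/geodesicP; split=> //; apply/eqP; rewrite eqn_leq ss.
by apply/dist_near; exists s.
Qed.

Lemma geodesic_rev x y p : geodesic e x y p ->
  exists2 q, geodesic e y x q & y :: q =i x :: p.
Proof.
move=> /geodesicP[[pp lp] sp]; exists (rev (belast x p)).
  apply/geodesicP; split; last by rewrite size_rev size_belast sp dC.
  split; first by rewrite -lp rev_path (eq_path (e' := e)) // => u v; rewrite e_sym.
  by case: p {pp sp} lp => [|z p] //= _; rewrite rev_cons last_rcons.
by move=> w; rewrite -lp -rev_rcons -lastI mem_rev.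
Qed.

Lemma geodesic_edge x y p i : geodesic e x y p -> i < size p ->
  e (nth x (x :: p) i) (nth x (x :: p) i.+1).
Proof. by case=> [[/(pathP x) pp _] _] ip; apply: pp. Qed.

Lemma geodesic_dist x y p i j : geodesic e x y p -> i <= j <= size p ->
  d (nth x (x :: p) i) (nth x (x :: p) j) = j - i.
Proof.
move=> gp; have /geodesicP[[pp lp] sp] := gp.
have le k l : k <= l <= size p -> d (nth x (x :: p) k) (nth x (x :: p) l) <= l - k.
  move=> /andP[kl lp']; apply/dist_near.
  rewrite -{1}(subnKC kl); apply: near_walk => k' ?.
  by apply: (geodesic_edge gp); lia.
move=> /andP[ij jp]; have := le _ _ (introT andP (conj ij jp)).
have := le 0 i; have := le j (size p).
have -> : nth x (x :: p) (size p) = y by rewrite -lp nth_last.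
rewrite [nth x (x :: p) 0]/= => a b c.
have := tri (nth x (x :: p) i) x y.
have := tri (nth x (x :: p) j) (nth x (x :: p) i) y.
rewrite -sp; lia.
Qed.

Lemma geodesic_mem_dist x y p w : geodesic e x y p -> w \in x :: p -> d x w <= d x y.
Proof.
move=> gp wp; have /geodesicP[[pp _] <-] := gp; exact: dist_path.
Qed.

Definition slim n := forall x y z p q r,
  geodesic e x y p -> geodesic e y z q -> geodesic e x z r ->
  forall w, w \in x :: p ->
    exists2 w', (w' \in y :: q) || (w' \in x :: r) & d w w' <= n.

Lemma hyperbolic_slim : gromov_hyperbolic e -> exists n, slim n.
Proof.
case=> n slim; exists n => x y z p q r gp gq gr w wp.
have [w' w'in [s ws sn]] := slim _ _ _ _ _ _ gp gq gr w wp.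
by exists w' => //; apply/dist_near; exists s.
Qed.

(** Cut the quadrilateral along the diagonal from [x] to [y'] and apply slimness
    to both triangles. *)
Lemma slim_quadrilateral n x y x' y' p p' w : slim n ->
  geodesic e x y p -> geodesic e x' y' p' -> w \in x :: p ->
  [\/ exists2 w', w' \in x' :: p' & d w w' <= 2 * n,
      d x w <= d x x' + 2 * n | d w y <= d y y' + 2 * n].
Proof.
move=> sl gp gp' wp.
have [q gq] := geodesic_ex x y'; have [r gr] := geodesic_ex y y'.
have [s gs] := geodesic_ex x x'.
have [q' gq' eq'] := geodesic_rev gp'.
have [w1 + ww1] := sl _ _ _ _ _ _ gp gr gq w wp.
case/orP=> [w1r|w1q].
  apply: Or33; have := geodesic_mem_dist gr w1r.
  by have := tri w1 w y; rewrite (dC w1 y); lia.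
have [w2 + ww2] := sl _ _ _ _ _ _ gq gq' gs w1 w1q.
have ww2' : d w w2 <= 2 * n.
  by have := tri w1 w w2; lia.
case/orP=> [w2p|w2s]; first by apply: Or31; exists w2; rewrite -?eq'.
apply: Or32; have := geodesic_mem_dist gs w2s.
by have := tri w2 x w; rewrite (dC w2 w); lia.
Qed.

Lemma path_crossing (r : rel V) (P : pred V) x s : path r x s ->
  P x -> ~~ P (last x s) ->
  exists w z, [/\ w \in x :: s, z \in x :: s, r w z, P w & ~~ P z].
Proof.
elim: s x => [|y s IHs] x /=; first by move=> _ ->.
case/andP=> rxy ps Px nP; have [Py|nPy] := boolP (P y).
  have [w [z [ws zs rwz Pw Pz]]] := IHs y ps Py nP.
  by exists w, z; split=> //; rewrite inE ?ws ?zs orbT.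
by exists x, y; split; rewrite ?inE ?eqxx ?orbT.
Qed.

(** Let [ab] be the edge of [p] at position [i].  Take [u] and [v] on [p] at
    distance [2 n] from [a] and [b] on either side: the balls of radius [2 n]
    around [u] and [v] are disjoint, and by slimness each of them meets [p'].
    Going from [a] to [u] and to [p'] inside the first ball, then along [p'],
    then to [v] and [b] inside the second ball, one joins [a] to [b] by a walk
    of length at most [16 n + 1].  A simple walk extracted from it has to leave
    the first ball through an edge of [p'].  Unless this walk is the edge [ab]
    itself, adding [ab] to it yields the required circuit. *)
Lemma fellow_travel n D x y x' y' p p' i : slim n ->
  geodesic e x y p -> geodesic e x' y' p' -> d x x' <= D -> d y y' <= D ->
  D + 4 * n < i -> i + D + 4 * n + 1 < size p ->
  let a := nth x (x :: p) i in
  let E := [set a; nth x (x :: p) i.+1] in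
  exists k, [/\ k < size p',
    circuit_nbhd e (16 * n + 2) E (nth x' (x' :: p') k),
    circuit_nbhd e (16 * n + 2) E (nth x' (x' :: p') k.+1) &
    d a (nth x' (x' :: p') k) <= 16 * n + 2].
Proof.
move=> sl gp gp' xx' yy' Di iD a; set b := nth x (x :: p) i.+1; move=> E.
pose f := nth x (x :: p); pose f' := nth x' (x' :: p').
have /geodesicP[[_ lp] sp] := gp.
have f_end : f (size p) = y by rewrite -lp /f nth_last.
have df j k : j <= k <= size p -> d (f j) (f k) = k - j.
  by move=> jk; apply: geodesic_dist gp jk.
have close j : D + 2 * n < j -> j + D + 2 * n < size p ->
    exists2 k, k <= size p' & d (f j) (f' k) <= 2 * n.
  move=> Dj jD; have fj : f j \in x :: p by apply: mem_nth => /=; lia.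
  have [[w wp' fw]|le|le] := slim_quadrilateral sl gp gp' fj.
  - have /(nthP x')[k kp' wk] := wp'.
    by exists k; rewrite // /f' wk.
  - by have := df 0 j; rewrite {1}/f /=; lia.
  - by have := df j (size p); rewrite f_end; lia.
set L := 2 * n.
have [||k0 k0p uk0] := close (i - L); [rewrite /L; lia..|].
have [||k1 k1p vk1] := close (i.+1 + L); [rewrite /L; lia..|].
set u := f (i - L) in uk0; set v := f (i.+1 + L) in vk1.
have uv : d u v = 2 * L + 1 by rewrite /u /v df; lia.
have ua : d u a = L by rewrite /u /a -/(f i) df; lia.
have ub : d u b = L + 1 by rewrite /u /b -/(f i.+1) df; lia.
have av : d a v = L + 1 by rewrite /v /a -/(f i) df; lia.
have vb : d b v = L by rewrite /v /b -/(f i.+1) df; lia.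
pose con s t := exists2 k, k < size p' &
  (s = f' k /\ t = f' k.+1) \/ (t = f' k /\ s = f' k.+1).
(* Extracting the simple walk inside this subgraph, rather than inside the whole
   graph, is what forces its crossing step to be an edge of [p']. *)
pose r : rel V := fun s t =>
  [|| in_ball cg u L s t, in_ball cg v L s t | `[< con s t >]].
have con_sym s t : con s t -> con t s.
  by case=> k kp [[-> ->]|[-> ->]]; exists k => //; [right | left].
have r_sym : symmetric r.
  move=> s t; rewrite /r !(in_ball_sym sg _ _ _ s); congr [|| _, _ | _].
  by apply/asboolP/asboolP; apply: con_sym.
have subu : subrel (in_ball cg u L) r by move=> s t H; rewrite /r H.
have subv : subrel (in_ball cg v L) r by move=> s t H; rewrite /r H orbT.
have re : subrel r e.
  move=> s t /or3P[/and3P[]//|/and3P[]//|/asboolP[k kp [[-> ->]|[-> ->]]]].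
    exact: geodesic_edge gp' kp.
  by rewrite e_sym; apply: geodesic_edge gp' kp.
have walk k l : k <= l <= size p' -> near r (f' k) (f' l) (l - k).
  move=> /andP[kl lp']; rewrite -{1}(subnKC kl); apply: near_walk => j ?.
  by apply/or3P; apply: Or33; apply/asboolP; exists j; [lia | left].
have k01 : near r (f' k0) (f' k1) (8 * n + 1).
  have := tri v u (f' k1); have := tri u (f' k0) (f' k1).
  rewrite (dC (f' k0) u) => t1 t2.
  have [le|le] := leqP k0 k1.
    have := geodesic_dist gp' (i := k0) (j := k1); rewrite -/f' => dk.
    by apply: near_leq (walk k0 k1 _); lia.
  have := geodesic_dist gp' (i := k1) (j := k0); rewrite -/f' => dk.
  rewrite (dC (f' k1)) in dk.
  by apply: near_sym => //; apply: near_leq (walk k1 k0 _); lia.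
have ab : near r a b (L + (L + ((8 * n + 1) + (L + L)))).
  apply: (@near_trans _ _ _ u).
    by apply: near_sub subu (near_in_ball _); rewrite -/(d _ _) dC ua.
  apply: (@near_trans _ _ _ (f' k0)).
    apply: near_sym => //; apply: near_sub subu (near_in_ball _).
    by rewrite -/(d _ _) dC.
  apply: near_trans k01 _; apply: (@near_trans _ _ _ v).
    by apply: near_sub subv (near_in_ball _); rewrite -/(d _ _) dC.
  by apply: near_sym => //; apply: near_sub subv (near_in_ball _); rewrite -/(d _ _) vb.
have [s [ps ls] [Us ss]] := near_simple ab.
have pes : path e a s by apply: sub_path ps.
have [w [z [ws zs rwz wu zu]]] : exists w z, [/\ w \in a :: s, z \in a :: s, r w z,
    d w u <= L & ~~ (d z u <= L)].
  apply: (path_crossing (P := fun w => d w u <= L) ps).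
    by rewrite dC ua.
  by rewrite ls dC ub; lia.
have conwz : con w z.
  case/or3P: rwz => [/and3P[_ _ zu']|/and3P[_ wv _]|/asboolP //].
    by rewrite zu' in zu.
  have := tri w u v; have := wv.
  by rewrite (dC u w) -/(d w v); lia.
have in_nb t : t \in a :: s -> circuit_nbhd e (16 * n + 2) E t.
  have eab : e a b by apply: geodesic_edge gp _; lia.
  have [s1|] := leqP (size s) 1; last first.
    by move=> s1 ts; apply: simple_path_circuit_nbhd ts => //; rewrite /L in ss; lia.
  case: s s1 {ps ws zs pes Us ss} ls => [|t' [|? ?]] //= _ lt.
    by have := ub; rewrite -lt ua; lia.
  by rewrite !inE lt => /orP[]/eqP->; left; [left | right].
have da t : t \in a :: s -> d a t <= 16 * n + 2.
  by move=> ts; have := dist_path cg pes ts; rewrite -/d /L in ss *; lia.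
by case: conwz => k kp [] [E1 E2]; exists k; split=> //;
   rewrite -/f' -?E1 -?E2; auto.
Qed.

End Geodesics.

(** * Linear growth of centralisers *)

Section Growth.
Variables (G : groupType) (V : choiceType) (e : rel V) (act : G -> V -> V).
Hypotheses (sg : simple_graph e) (cg : connected_graph e) (ga : graph_action e act).
Hypotheses (fe : fine e)
  (fs : forall E, edges e E -> finite_set (edge_stabiliser act E))
  (fo : finite_set [set edge_orbit act E | E in edges e]).
Local Open Scope group_scope.
Implicit Types (g h c : G) (x y z v w : V) (E : set V).

Let d := dist cg.
Let dC x y : d x y = d y x. Proof. exact: dist_sym. Qed.
Let tri y x z : d x z <= d x y + d y z. Proof. exact: dist_triangle. Qed.
Let d_act g x y : d (act g x) (act g y) = d x y. Proof. exact: dist_act. Qed.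

Lemma act_setK g E : act g^-1 @` (act g @` E) = E.
Proof.
rewrite image_comp; have -> : act g^-1 \o act g = id by apply/funext/(actK ga).
exact: image_id.
Qed.

Lemma act_set1 E : act 1 @` E = E.
Proof.
have -> : act 1 = id by apply/funext/(act1 ga).
exact: image_id.
Qed.

Lemma orbit_uniform (Q : set V -> nat -> Prop) :
  (forall E m n, m <= n -> Q E m -> Q E n) ->
  (forall g E n, Q E n -> Q (act g @` E) n) ->
  (forall E, edges e E -> exists n, Q E n) ->
  exists n, forall E, edges e E -> Q E n.
Proof.
move=> Qmono Qact Qex.
have [|n Qn] := finite_uniform (Q := fun (O : set (set V)) n => forall E, O E -> Q E n) fo
  (fun O m n mn QO E OE => Qmono E m n mn (QO E OE)).
  move=> _ [E EE <-]; have [n QE] := Qex E EE.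
  by exists n => _ [g _ <-]; apply: Qact.
exists n => E EE; apply: (Qn (edge_orbit act E)); first by exists E.
by exists 1 => //; apply: act_set1.
Qed.

Lemma circuit_nbhd_act g n E w : circuit_nbhd e n E w ->
  circuit_nbhd e n (act g @` E) (act g w).
Proof.
have inj := can_inj (actK ga g).
case=> [Ew|[s [[s2 /andP[ps Us]] sn [x xs ->]] ws]]; first by left; exists w.
right; exists (map (act g) s); last exact: map_f.
split; last 1 first.
- exists (act g x); first exact: map_f.
  by rewrite image_setU !image_set1 next_map.
- split; rewrite ?size_map // /ucycle map_inj_uniq // Us andbT cycle_map.
  by rewrite (eq_cycle (e' := e)) // => u v /=; rewrite (act_edge ga).
- by rewrite size_map.
Qed.

Lemma circuit_nbhd_uniform n :
  exists N, forall E, edges e E -> at_most (circuit_nbhd e n E) N.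
Proof.
apply: (orbit_uniform (Q := fun E N => at_most (circuit_nbhd e n E) N)).
- by move=> E p q pq Ep s Us sE; apply: leq_trans pq; apply: Ep.
- move=> g E N EN s Us sE; rewrite -(size_map (act g^-1)); apply: EN.
    by rewrite map_inj_uniq //; apply: can_inj (actK ga _).
  by move=> _ /mapP[w ws ->]; rewrite -(act_setK g E); apply/circuit_nbhd_act/sE.
- by move=> E EE; apply/finite_at_most/finite_circuit_nbhd.
Qed.

Lemma edge_stabiliser_uniform :
  exists N, forall E, edges e E -> at_most (edge_stabiliser act E) N.
Proof.
apply: (orbit_uniform (Q := fun E N => at_most (edge_stabiliser act E) N)).
- by move=> E p q pq Ep s Us sE; apply: leq_trans pq; apply: Ep.
- move=> g E N EN s Us sE; rewrite -(size_map (conjg^~ g)); apply: EN.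
    by rewrite map_inj_uniq //; apply: conjg_inj.
  move=> _ /mapP[h hs ->]; have := sE h hs; rewrite /edge_stabiliser /= => hE.
  have -> : act (h ^ g) = act g^-1 \o (act h \o act g).
    by apply/funext => x; rewrite conjgE !(actM ga).
  by rewrite !image_comp in hE *; rewrite -image_comp hE act_setK.
- by move=> E EE; apply/finite_at_most/fs.
Qed.

(** The edge [E] is taken on a geodesic from [x] to a far translate of [x], at
    position just above [D + 4 n], where [n] is the slimness constant.  An
    element [h] is then recorded by the position [k <= i + D + O(n)] of an edge
    of the geodesic and by the image of that edge under [h], whose ends lie in
    the circuit neighbourhood of [E]; [2 * D + 20 * n + 4] exceeds
    [i + (D + (16 * n + 2))]. *)
Lemma centraliser_linear_growth : gromov_hyperbolic e ->
  exists A B, forall c x D, acts_freely act c ->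
    at_most [set h | commute h c /\ d x (act h x) <= D] (A * D + B)%N.
Proof.
move/(hyperbolic_slim cg)=> [n sl].
have [N1 nbN] := circuit_nbhd_uniform (16 * n + 2).
have [N2 stN] := edge_stabiliser_uniform.
exists (2 * (N1 * N1) * N2)%N, ((20 * n + 4) * (N1 * N1) * N2)%N => c x D free.
have [m xm] := free_unbounded sg cg ga fe x (2 * D + 8 * n + 3) free.
have [p gp] := geodesic_ex cg x (act (c ^+ m) x).
have /geodesicP[_ sp] := gp; rewrite -[dist _ _ _]sp in xm.
pose f := nth x (x :: p); pose i := (D + 4 * n + 1)%N; pose E := [set f i; f i.+1].
have fE k : k < size p -> edges e [set f k; f k.+1].
  by move=> kp; exists (f k), (f k.+1); split=> //; apply: geodesic_edge gp kp.
have EE : edges e E by apply: fE; rewrite /i; lia.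
have [r0 r0E] := (finite_seqP _).1 (finite_circuit_nbhd (16 * n + 2) fe EE).
pose r := undup r0.
have rP w : circuit_nbhd e (16 * n + 2) E w <-> w \in r by rewrite r0E mem_undup.
have rN : size r <= N1.
  by apply: (nbN E EE); [exact: undup_uniq | move=> w /rP].
pose R h (t : nat * (V * V)) :=
  [/\ t.1 < size p, act h (f t.1) = t.2.1 & act h (f t.1.+1) = t.2.2].
have RN t : at_most [set h | R h t] N2.
  have [tp|tp] := ltnP t.1 (size p); last first.
    by case=> // h s _ /(_ h (mem_head _ _))[]; rewrite ltnNge tp.
  have := edge_transporter_at_most ga (x' := t.2.1) (y' := t.2.2) (stN _ (fE _ tp)).
  by move=> H s Us sR; apply: H => // h /sR[].
pose ts := [seq (k, q) | k <- iota 0 (2 * D + 20 * n + 4),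
                         q <- [seq (u, v) | u <- r, v <- r]].
move=> s Us sC.
have := at_most_fibres RN (r := ts) Us; rewrite !size_allpairs size_iota => le.
apply: (@leq_trans ((2 * D + 20 * n + 4) * (size r * size r) * N2)); last first.
  have rr : size r * size r <= N1 * N1 by apply: leq_mul.
  apply: (@leq_trans ((2 * D + 20 * n + 4) * (N1 * N1) * N2)); last by nia.
  by rewrite leq_mul2r leq_mul2l rr !orbT.
apply: le => h /sC[hc hD].
have ghp : geodesic e (act h x) (act h (act (c ^+ m) x)) (map (act h) p).
  apply/geodesicP; split; last by rewrite size_map sp -/d d_act.
  have [[pp lp] _] := gp; split; last by rewrite last_map lp.
  by rewrite path_map (eq_path (e' := e)) // => u v /=; rewrite (act_edge ga).
have hD' : d (act (c ^+ m) x) (act h (act (c ^+ m) x)) <= D.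
  by rewrite -(actM ga) (commuteX m hc) (actM ga) d_act.
have [||k [kp nk nk1 dk]] := fellow_travel sg sl gp ghp hD hD' (i := i);
  [rewrite /i; lia.. |].
rewrite size_map in kp.
have fh j : j <= size p -> nth (act h x) (act h x :: map (act h) p) j = act h (f j).
  by move=> jp; rewrite -[_ :: _]/(map (act h) (x :: p)) (nth_map x).
rewrite !fh ?(ltnW kp) // in nk nk1 dk.
exists (k, (act h (f k), act h (f k.+1))); last by split.
apply: allpairs_f; last by apply: allpairs_f; apply/rP.
rewrite mem_iota add0n leq0n /=.
have dx j : j <= size p -> d x (f j) = j.
  by move=> jp; have := geodesic_dist cg gp (i := 0) (j := j); rewrite subn0; apply.
have := dx k (ltnW kp); have := dx i; have := d_act h x (f k).
have := tri x (act h x) (act h (f k)); have := tri (f i) x (act h (f k)).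
rewrite (dC (act h x) x) -/(d _ _) -/(f i) in dk *.
by rewrite /i in dk *; lia.
Qed.

(** The subset [E1] of elements centralising some positive power of [c] is
    treated first: [M] of its cosets have representatives commuting with a
    common power of [c], so linear growth applies to all [g c^i] at once and its
    constants are independent of that power.  The rest of the elementary
    closure, if nonempty, is a single translate of [E1]. *)
Lemma elementary_finite_index c : gromov_hyperbolic e -> acts_freely act c ->
  finite_index (powers c) (elementary c).
Proof.
move=> hyp free; have [x] : inhabited V by case: cg.
have [A [B growth]] := centraliser_linear_growth hyp.
have Ps := powers_subgroup c; pose coset g := left_coset g (powers c).
pose E1 : set G := [set g | exists2 p, 0 < p & (c ^+ p) ^ g = c ^+ p].
have fE1 : finite_set [set coset g | g in E1].
  apply: (@at_most_finite _ _ (A * d x (act c x))) => s Us sE1.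
  have [gs gsE1 sgs] : exists2 gs, (forall g, g \in gs -> E1 g) & s = map coset gs.
    elim: s {Us} sE1 => [|C s IHs] sE1; first by exists [::].
    have [g E1g gC] := sE1 C (mem_head _ _).
    have [|gs gsE1 sgs] := IHs; first by move=> C' C's; apply: sE1; rewrite inE C's orbT.
    exists (g :: gs); last by rewrite /= gC sgs.
    by move=> h; rewrite inE => /orP[/eqP->|/gsE1].
  have [p p0 comm_gs] : exists2 p, 0 < p & forall g, g \in gs -> commute g (c ^+ p).
    elim: gs gsE1 {sgs} => [|g gs IHgs] gsE1; first by exists 1%N.
    have [|p p0 cp] := IHgs; first by move=> h hs; apply: gsE1; rewrite inE hs orbT.
    have [q q0 cq] := gsE1 g (mem_head _ _).
    exists (p * q)%N; first by rewrite muln_gt0 p0.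
    move=> h; rewrite inE => /orP[/eqP->|/cp hp]; last first.
      by rewrite expgnA; apply: commuteX.
    rewrite mulnC expgnA; apply: commuteX.
    by rewrite /commute -[in RHS](mulVKg g (c ^+ q * g)) -conjgE cq.
  have [D gsD] : exists D, forall g, g \in gs -> d x (act g x) <= D.
    apply: (finite_uniform (S := [set` gs]) (Q := fun g D => d x (act g x) <= D)).
    - exact: finite_seq.
    - by move=> g m n mn gm; apply: leq_trans gm mn.
    - by move=> g _; exists (d x (act g x)).
  have dX i : d x (act (c ^+ i) x) <= i * d x (act c x).
    elim: i => [|i IHi]; first by rewrite expg0 (act1 ga) /d distxx.
    have := tri (act (c ^+ i) x) x (act (c ^+ i.+1) x).
    by rewrite {2}expgSr (actM ga) d_act mulSn; lia.
  have oo : infinite_order c.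
    by move=> q q0 cq; apply: (free q x q0); rewrite cq (act1 ga).
  have freep : acts_freely act (c ^+ p).
    by move=> q y q0; rewrite -expgnA; apply: free; rewrite muln_gt0 p0.
  have [n nE] : exists n, n = (A * D + B).+1 by exists (A * D + B).+1.
  pose hs := [seq g * c ^+ i | g <- gs, i <- iota 0 n].
  have Uhs : uniq hs.
    apply: allpairs_uniq; first by apply: (@map_uniq _ _ coset); rewrite -sgs.
      exact: iota_uniq.
    move=> [g i] [h j] /allpairsP[[g' i'] [/= gg _ [-> _]]].
    move=> /allpairsP[[h' j'] [/= hh _ [-> _]]] /= gh.
    have e_gh : coset g' = coset h'.
      apply/(left_cosetP _ _ Ps).
      rewrite -(mulgK (c ^+ j) h') -gh !mulgA mulVg mul1g; exact: powersB.
    have {e_gh}e_gh : g' = h'.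
      rewrite -(nth_index 1 gg) -(nth_index 1 hh); congr nth.
      have ig : index g' gs < size s by rewrite sgs size_map index_mem.
      have ih : index h' gs < size s by rewrite sgs size_map index_mem.
      apply/eqP; rewrite -(nth_uniq (coset 1) ig ih Us) sgs.
      by rewrite !(nth_map 1) ?index_mem // !nth_index // e_gh.
    by rewrite e_gh in gh *; move/mulgI/(infinite_order_inj oo): gh => ->.
  have := growth _ x (D + n * d x (act c x)) freep hs Uhs.
  rewrite size_allpairs size_iota sgs size_map => le.
  have {}le : size gs * n <= A * (D + n * d x (act c x)) + B.
    apply: le => _ /allpairsP[[g i] [/= gg ii ->]]; split.
      apply: commute_sym; apply: commuteM; first exact/commute_sym/comm_gs.
      exact: commuteX2.
    have := tri (act g x) x (act (g * c ^+ i) x); rewrite (actM ga) d_act.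
    have := gsD g gg; have := dX i; rewrite mem_iota in ii; nia.
  rewrite leqNgt; apply/negP => gt.
  have := leq_trans (leq_mul gt (leqnn n)) le.
  by rewrite mulSn mulnDr mulnCA mulnC {1}nE; nia.
split=> [g [n gn]|].
  exists 1%N => //; left; apply/conjg_fixP/commgP.
  by rewrite expg1; case: gn => ->; [|apply: commuteV]; apply: commuteX.
have [[t Et nE1t]|allE1] := pselect (exists2 t, elementary c t & ~ E1 t); last first.
  apply: sub_finite_set fE1 => _ [g Eg <-]; exists g => //.
  by apply: contrapT => nE1; apply: allE1; exists g.
have inv g : elementary c g -> ~ E1 g -> exists2 p, 0 < p & (c ^+ p) ^ g = (c ^+ p)^-1.
  by case=> p p0 [] gp nE1; [case: nE1; exists p | exists p].
apply: (@sub_finite_set _ _ ([set coset g | g in E1] `|`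
    (fun C => left_coset t C) @` [set coset g | g in E1])); last first.
  by rewrite finite_setU; split=> //; apply: finite_image.
move=> _ [g Eg <-]; have [E1g|nE1g] := pselect (E1 g); first by left; exists g.
right; exists (coset (t^-1 * g)); last first.
  apply/seteqP; split=> [_ [_ [z Cz <-] <-]|_ [z Cz <-]].
    by exists z => //; rewrite !mulgA mulgV mul1g.
  by exists (t^-1 * g * z); [exists z | rewrite !mulgA mulgV mul1g].
exists (t^-1 * g) => //.
have [p p0 tp] := inv t Et nE1t; have [q q0 gq] := inv g Eg nE1g.
exists (p * q)%N; first by rewrite muln_gt0 p0.
have tpq : (c ^+ (p * q)) ^ t^-1 = (c ^+ (p * q))^-1.
  apply: (@conjg_inj _ t); rewrite conjgKV conjVg.
  by rewrite expgnA conjXg tp expVgn invgK.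
rewrite conjgM tpq conjVg mulnC expgnA conjXg gq.
by rewrite expVgn invgK.
Qed.

End Growth.

(** * The adapted collection *)

Lemma FIN_sub_VC (G : groupType) : @FIN G `<=` @VC G.
Proof.
move=> A [As fA]; split=> //; exists (generated [set 1%g]); first by exists 1%g.
split; last exact: finite_image.
by apply: smallest_sub => // _ ->; case: As.
Qed.

Section Peripheral.
Variables (G : groupType) (V : choiceType) (e : rel V) (act : G -> V -> V).
Hypotheses (sg : simple_graph e) (cg : connected_graph e) (ga : graph_action e act).
Hypotheses (he : gromov_hyperbolic e) (fe : fine e)
  (fs : forall E, edges e E -> finite_set (edge_stabiliser act E))
  (fo : finite_set [set edge_orbit act E | E in edges e]).
Local Open Scope group_scope.
Implicit Types (A N : set G) (c g : G) (x y : V).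

Let stab := vertex_stabiliser act.
Let stab_subgroup x : is_subgroup (stab x). Proof. exact: (stabiliser_subgroup ga). Qed.

Lemma stabiliser_inj x y : infinite_set (stab x `&` stab y) -> x = y.
Proof.
move=> inf; apply: contrapT => xy; apply: inf.
exact: (stabilisers_inter sg cg ga fe fs xy).
Qed.

Lemma normaliser_stabiliser x : infinite_set (stab x) -> normaliser (stab x) = stab x.
Proof.
move=> inf; apply/seteqP; split=> [g|]; last exact/sub_normaliser/stab_subgroup.
rewrite /normaliser /= (conj_stabiliser ga) => gx.
by apply: stabiliser_inj; rewrite /stab gx setIid.
Qed.

Lemma infinite_vc_element N : infinite_vc N -> exists2 c, N c & infinite_order c.
Proof.
move=> /infinite_vcP[_ [c oo [CN _]]]; exists c => //; apply: CN.
by exists 1%N; left; rewrite expg1.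
Qed.

(** Some power [b] of a generator of finite index fixes [x].  For [g] in [N], a
    further power of [b] is conjugated by [g] to itself or to its inverse, hence
    fixes both [x] and [g x]; two vertices with infinite common stabiliser coincide. *)
Lemma infinite_vc_sub_stabiliser N x : infinite_vc N ->
  infinite_set (N `&` stab x) -> N `<=` stab x.
Proof.
move=> vcN inf; have /infinite_vcP[Ns [c oo fC]] := vcN.
have Ss := stab_subgroup x.
have [|q q0 [Ncq cqx]] := infinite_subgroup_power fC (is_subgroupI Ns Ss) _ inf.
  by move=> ? [].
have ooq := infinite_orderX q0 oo.
move=> g Ng; have Ngi : N g^-1 by case: Ns => _ _; apply.
have [p p0 gp] := normaliser_sub_elementary vcN Ncq ooq (sub_normaliser Ns Ng).
apply/esym/stabiliser_inj.
apply: (@infinite_powers _ _ ((c ^+ q) ^+ p)); first exact: infinite_orderX.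
  exact/is_subgroupI/stab_subgroup.
have fixp : stab x ((c ^+ q) ^+ p) by apply: subgroupX.
split=> //; rewrite /stab -(conj_stabiliser ga); apply/conj_setE.
exact: subgroup_eqVinv gp fixp.
Qed.

Lemma infinite_vc_acts_freely N c : infinite_vc N -> N c -> infinite_order c ->
  (forall x, ~ N `<=` stab x) -> acts_freely act c.
Proof.
move=> vcN Nc oo nper q x q0 fixq; apply: (nper x).
have /infinite_vcP[Ns _] := vcN.
apply: infinite_vc_sub_stabiliser => //.
apply: (@infinite_powers _ _ (c ^+ q)); first exact: infinite_orderX.
  exact/is_subgroupI/stab_subgroup.
by split=> //; apply: subgroupX.
Qed.

Lemma acts_freely_infinite_order c : acts_freely act c -> infinite_order c.
Proof.
have [x] : inhabited V by case: cg.
by move=> free q q0 cq; apply: (free q x q0); rewrite cq (act1 ga).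
Qed.

Lemma elementary_infinite_vc c : acts_freely act c -> infinite_vc (elementary c).
Proof.
move=> free; apply/infinite_vcP; split; first exact: elementary_subgroup.
exists c; first exact: acts_freely_infinite_order.
exact: (elementary_finite_index sg cg ga fe fs fo).
Qed.

Lemma infinite_vc_sub_elementary N c : infinite_vc N -> N c -> infinite_order c ->
  N `<=` elementary c.
Proof.
move=> vcN Nc oo; apply: subset_trans (normaliser_sub_elementary vcN Nc oo).
by apply: sub_normaliser; case/infinite_vcP: vcN.
Qed.

Lemma elementary_maximal c : acts_freely act c -> maximal_infinite_vc (elementary c).
Proof.
move=> free; split=> [|N vcN EN]; first exact: elementary_infinite_vc.
apply/seteqP; split=> //; apply: infinite_vc_sub_elementary => //.
  exact/EN/mem_elementary.
exact: acts_freely_infinite_order.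
Qed.

(** An infinite intersection contains a positive power of [b], which has the
    same elementary closure as [b]; so [elementary c] is contained in
    [elementary b], and maximality gives equality. *)
Lemma elementary_eq b c : acts_freely act b -> acts_freely act c ->
  infinite_set (elementary b `&` elementary c) -> elementary b = elementary c.
Proof.
move=> fb fc inf; have vcb := elementary_infinite_vc fb.
have vcc := elementary_infinite_vc fc.
have fin := elementary_finite_index sg cg ga fe fs fo he fb.
have subb := elementary_subgroup b; have subc := elementary_subgroup c.
have [|q q0 [_ cq]] := infinite_subgroup_power fin (is_subgroupI subb subc) _ inf.
  by move=> ? [].
have oob := acts_freely_infinite_order fb.
have [_ maxc] := elementary_maximal fc; apply: maxc => //.
have bq : eqVinv (b ^+ q) ((b ^+ q) ^+ 1) by left; rewrite expg1.
rewrite (elementary_commensE q0 (ltn0Sn 0) bq).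
exact: infinite_vc_sub_elementary (infinite_orderX q0 oob).
Qed.

Lemma acts_freelyJ c g : acts_freely act c -> acts_freely act (c ^ g).
Proof.
move=> free q x q0; rewrite -conjXg conjgE !(actM ga) => /(congr1 (act g)).
by rewrite (actVK ga); apply: free.
Qed.

Section Family.
Variables (k : nat) (H : 'I_k -> set G).
Hypothesis perE : [set A | infinite_set A /\ exists x, A = vertex_stabiliser act x]
  = peripheral_subgroups H.

Lemma peripheralP A :
  peripheral_subgroups H A <-> exists2 x, A = stab x & infinite_set (stab x).
Proof.
rewrite -perE; split=> [[inf [x Ax]]|[x -> inf]]; last by split=> //; exists x.
by exists x => //; rewrite /stab -Ax.
Qed.

(** This description makes closure under conjugation immediate, as the
    elementary closure of a conjugate is the conjugate of the elementary
    closure. *)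
Lemma maximal_nonperipheralP A :
  maximal_nonperipheral_vc H A <-> exists2 c, acts_freely act c & A = elementary c.
Proof.
split=> [[[vcA maxA] nper]|[c free ->]].
  have [c Ac oo] := infinite_vc_element vcA.
  have free : acts_freely act c.
    apply: (infinite_vc_acts_freely vcA Ac oo) => x Ax.
    have [g [i stE]] : peripheral_subgroups H (stab x).
      apply/peripheralP; exists x => //; case: vcA => _; exact: sub_infinite_set.
    by apply: (nper g i); rewrite -stE.
  exists c => //; apply/esym/maxA; first exact: elementary_infinite_vc.
  exact: infinite_vc_sub_elementary.
split=> [|g i sub]; first exact: elementary_maximal.
have /peripheralP[x stE _] : peripheral_subgroups H (conj_set g (H i)) by exists g, i.
apply: (free 1%N x) => //; rewrite expg1.
by have := sub c (mem_elementary c); rewrite stE.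
Qed.

Lemma adapted_collection :
  adapted (@FIN G) (@VC G) (peripheral_subgroups H `|` maximal_nonperipheral_vc H).
Proof.
have subgroup A :
    (peripheral_subgroups H `|` maximal_nonperipheral_vc H) A -> is_subgroup A.
  case=> [/peripheralP[x -> _]|/maximal_nonperipheralP[c _ ->]].
    exact: (stabiliser_subgroup ga).
  exact: elementary_subgroup.
split=> //.
- exact: FIN_sub_VC.
- move=> A B HA HB; have [fAB|iAB] := pselect (finite_set (A `&` B)).
    by right; split=> //; apply: is_subgroupI; apply: subgroup.
  have vc_stab c x : acts_freely act c -> ~ infinite_set (elementary c `&` stab x).
    move=> free inf; apply: (free 1%N x) => //; rewrite expg1.
    have := infinite_vc_sub_stabiliser (elementary_infinite_vc free) inf.
    by apply; apply: mem_elementary.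
  left; case: HA HB iAB => [/peripheralP[x -> _]|/maximal_nonperipheralP[b fb ->]]
    [/peripheralP[y -> _]|/maximal_nonperipheralP[c fc ->]] inf.
  + by rewrite (stabiliser_inj inf).
  + by rewrite setIC in inf; case: (vc_stab c x fc inf).
  + by case: (vc_stab b y fb inf).
  + exact: elementary_eq.
- move=> A g [[h [i ->]]|/maximal_nonperipheralP[c fc ->]].
    left; exists (g * h), i; apply/seteqP; split=> x.
      by move=> /conj_setE/conj_setE xH; apply/conj_setE; rewrite conjgM.
    by move=> /conj_setE xH; apply/conj_setE/conj_setE; rewrite -conjgM.
  right; apply/maximal_nonperipheralP; exists (c ^ g^-1); first exact: acts_freelyJ.
  exact: conj_elementary.
- move=> A [/peripheralP[x -> inf]|/maximal_nonperipheralP[c fc ->]].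
    exact: normaliser_stabiliser.
  apply/seteqP; split; last exact/sub_normaliser/elementary_subgroup.
  apply: normaliser_sub_elementary; first exact: elementary_infinite_vc.
    exact: mem_elementary.
  exact: acts_freely_infinite_order.
- move=> A [vcA nfA]; have infA : infinite_vc A.
    by split=> // fA; apply: nfA; split=> //; case: vcA.
  have [[x Ax]|nper] := pselect (exists x, A `<=` stab x).
    exists (stab x) => //; left; apply/peripheralP; exists x => //.
    by case: infA => _; apply: sub_infinite_set.
  have [c Ac oo] := infinite_vc_element infA.
  have free : acts_freely act c.
    by apply: (infinite_vc_acts_freely infA Ac oo) => x Ax; apply: nper; exists x.
  exists (elementary c); last exact: infinite_vc_sub_elementary.
  by right; apply/maximal_nonperipheralP; exists c.
Qed.

End Family.
End Peripheral.

Theorem theorem2p6 (G : groupType) (k : nat) (H : 'I_k -> set G)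
  (fgG : finitely_generated [set: G])
  (sgH : forall i : 'I_k, is_subgroup (H i))
  (hypG : relatively_hyperbolic H) :
  adapted (@FIN G) (@VC G)
    (peripheral_subgroups H `|` maximal_nonperipheral_vc H).
Proof.
case: hypG => V [e [act [[sg cg ga] [[he fe] fo fs perE _]]]].
exact: (adapted_collection sg cg ga he fe fs fo perE).
Qed.
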